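(* Let $g$ and $d$ be positive integers with $d^2\mid g$, and let $P_\ast^{(g,d^2)}=L_{\mathcal{T}_{d^2},\tilde I_{2d}}(P_b^{(g,d^2)})$. Then there exists a set $\mathcal{P}$ of $d$ $(2g,2g,1,g(2g-1))$ PDAs that are Blackburn-compatible w.r.t. $P_\ast^{(g,d^2)}$ and such that $L_{\mathcal{P},P_\ast^{(g,d^2)}}(I_d)$ is a $2d$-regular $(2gd,\;2gd,\;2gd-3g+g/d+2d-d^2,\;g(3g-g/d-2d+d^2))$ PDA.
   Context: Notation: $[n]=\{0,1,\dots,n-1\}$; rows and columns are indexed from $0$. For positive integers $K,f$, a nonnegative integer $Z$ and a finite set $\mathcal{S}$ of integers, a $(K,f,Z,\mathcal{S})$ placement delivery array (PDA) is an $f\times K$ array $P=[p_{j,k}]$ with entries in $\mathcal{S}\cup\{\ast\}$ such that: (C1) $\ast$ appears exactly $Z$ times in each column; (C2) each $s\in\mathcal{S}$ occurs at least once; (C3, Blackburn property) if two distinct cells $(j_1,k_1)$, $(j_2,k_2)$ contain the same integer then $p_{j_1,k_2}=p_{j_2,k_1}=\ast$. It is $g$-regular if each integer of $\mathcal{S}$ occurs exactly $g$ times. A number $S$ in place of the set means the integer set has $S$ elements. Blackburn compatibility: for arrays $P_0,P_1,P_\ast$ of the same size, $P_0$ and $P_1$ are Blackburn-compatible w.r.t. $P_\ast$ if, whenever $p^{(0)}_{i_1j_1}=p^{(1)}_{i_2j_2}\neq\ast$, we have $p^{(\ast)}_{i_1j_2}=p^{(\ast)}_{i_2j_1}=\ast$.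 A family is Blackburn-compatible w.r.t. $P_\ast$ if any two different members of the family are. Lifting: for a $g_b$-regular PDA $P_b$, a family $\mathcal{P}=\{P_0,\dots,P_{g_b-1}\}$ and an array $P_\ast$, all of the same size, $L_{\mathcal{P},P_\ast}(P_b)$ is obtained from $P_b$ by replacing each $\ast$ by its own relabelled copy of $P_\ast$, and replacing, for each integer $s$, the $t$-th occurrence of $s$ (in a fixed order, $t=0,\dots,g_b-1$) by $P_{s,t}$, where $P_{s,0},\dots,P_{s,g_b-1}$ are obtained from $P_0,\dots,P_{g_b-1}$ by one common injective relabelling of integers depending on $s$; relabellings are chosen so that the integers used for different $s$ and for different copies of $P_\ast$ are all disjoint. In particular $L_{\mathcal{P},P_\ast}(I_d)$ is the $d\times d$ block array with $i$-th diagonal block $P_i$ and off-diagonal blocks integer-disjoint copies of $P_\ast$. $I_n(t)$ (resp. $\tilde I_n(t)$) is the $n\times n$ array with $t$ on the diagonal (resp. anti-diagonal) and $\ast$ elsewhere. For an $n\times n$ array $P$, $\pi_{AD,1}(P)$ equals $P$ except that each anti-diagonal entry at $(i,j)$ moves to $(i-1,j+1)$ mod $n$. $T_{d^2}$ is the $2d\times 2d$ array consisting of $d\times d$ blocks of size $2\times 2$, the block in block-row $a$ and block-column $b$ ($a,b\in[d]$) being $\tilde I_2(ad+b)$. $\mathcal{T}_{d^2}=\{\pi_{AD,1}^{2i}(T_{d^2}): i\in[d]\}$ (ordered by $i$). $P_b^{(g,d^2)}$ is the $(g/d)\times(g/d)$ $d$-regular PDA which is block diagonal with $d\times d$ diagonal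 blocks $I_d(0),I_d(1),\dots,I_d(g/d^2-1)$ and all-$\ast$ off-diagonal blocks. Thus $P_\ast^{(g,d^2)}$ is a $2g\times 2g$ array. *)

(* Defs.v *)
From mathcomp Require Export all_boot all_order all_algebra.
From mathcomp Require Export finmap.
From mathcomp.real_closed Require Export mxtens.

Set Implicit Arguments.
Unset Strict Implicit.
Unset Printing Implicit Defensive.

(* [None] encodes the star. *)
Definition array (m n : nat) := 'M[option int]_(m, n).

Definition all_star (m n : nat) : array m n := const_mx None.

Definition occurs m n (P : array m n) (s : int) : bool :=
  [exists i, exists j, P i j == Some s].

Definition mult m n (P : array m n) (s : int) : nat :=
  #|[set c : 'I_m * 'I_n | P c.1 c.2 == Some s]|.

(* The array sizes produced by block constructions equal the intended [f] and
   [K] only up to arithmetic, so these equalities are part of the predicate. *)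
Definition is_pda (K f Z : nat) (S : {fset int}) m n (P : array m n) : Prop :=
  [/\ (m = f /\ n = K) /\ (0 < f /\ 0 < K),
      forall i j s, P i j = Some s -> s \in S,
      forall j, #|[set i | P i j == None]| = Z,
      forall s, s \in S -> occurs P s
    & forall i1 j1 i2 j2 s, (i1, j1) != (i2, j2) ->
        P i1 j1 = Some s -> P i2 j2 = Some s ->
        P i1 j2 = None /\ P i2 j1 = None].

Definition is_pda_card (K f Z N : nat) m n (P : array m n) : Prop :=
  exists2 S : {fset int}, #|` S| = N & is_pda K f Z S P.

Definition is_regular_pda_card (r K f Z N : nat) m n (P : array m n) : Prop :=
  exists2 S : {fset int}, #|` S| = N &
    is_pda K f Z S P /\ (forall s, s \in S -> mult P s = r).

Definition blackburn_compat m n (P0 P1 Pstar : array m n) : Prop :=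
  forall i1 j1 i2 j2 s, P0 i1 j1 = Some s -> P1 i2 j2 = Some s ->
    Pstar i1 j2 = None /\ Pstar i2 j1 = None.

Definition blackburn_compat_family r m n (F : r.-tuple (array m n))
    (Pstar : array m n) : Prop :=
  forall t u : 'I_r, t != u -> blackburn_compat (tnth F t) (tnth F u) Pstar.

Definition block_array m n p q (B : 'I_m -> 'I_n -> array p q) :
    array (m * p) (n * q) :=
  (\matrix_(i, j) B (mxtens_unindex i).1 (mxtens_unindex j).1
                   (mxtens_unindex i).2 (mxtens_unindex j).2)%R.

(* The rank, from 0, of the cell (i, j) among the cells of P with the same
   content, in row-major order. *)
Definition occ_rank m n (P : array m n) (i : 'I_m) (j : 'I_n) : nat :=
  #|[set c : 'I_m * 'I_n |
      (P c.1 c.2 == P i j) && (mxtens_index c < mxtens_index (i, j))]|.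

Definition relabel m n (h : int -> int) (P : array m n) : array m n :=
  map_mx (omap h) P.

(* A relabelling for a lifting gives one map per star cell of the base array
   ([inl c]) and one map per integer of the base array ([inr s]). *)
Definition labelling (m n : nat) := (('I_m * 'I_n) + int) * int -> int.

Definition used r m n p q (F : r.-tuple (array p q)) (Pstar : array p q)
    (Pb : array m n) : pred ((('I_m * 'I_n) + int) * int) :=
  fun x => match x.1 with
           | inl c => (Pb c.1 c.2 == None) && occurs Pstar x.2
           | inr s => occurs Pb s && [exists t, occurs (tnth F t) x.2]
           end.

(* Injectivity on the used pairs says both that each relabelling is injective
   and that different relabellings produce disjoint sets of integers. *)
Definition admissible r m n p q (F : r.-tuple (array p q)) (Pstar : array p q)
    (Pb : array m n) (lab : labelling m n) : Prop :=
  {in used F Pstar Pb &, injective lab}.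

Lemma admissible_exists r m n p q (F : r.-tuple (array p q))
    (Pstar : array p q) (Pb : array m n) :
  exists lab : labelling m n, admissible F Pstar Pb lab.
Proof.
exists (fun x => Posz (choice.pickle x)) => x y _ _ [].
exact: (pcan_inj (@choice.pickleK _)).
Qed.

(* The default of [nth] is never reached when Pb is r-regular. *)
Definition lift r m n p q (F : r.-tuple (array p q)) (Pstar : array p q)
    (Pb : array m n) (lab : labelling m n) : array (m * p) (n * q) :=
  block_array (fun a b =>
    match Pb a b with
    | None => relabel (fun x => lab (inl (a, b), x)) Pstar
    | Some s => relabel (fun x => lab (inr s, x))
                        (nth (all_star p q) F (occ_rank Pb a b))
    end).

Definition diag_array (n : nat) (t : int) : array n n :=
  (\matrix_(i, j) if j == i then Some t else None)%R.

Definition antidiag_array (n : nat) (t : int) : array n n :=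
  (\matrix_(i, j) if j == rev_ord i then Some t else None)%R.

(* The entry at (i, j) comes from (i + 1, j - 1) modulo n. *)
Definition pi_AD1 n (P : array n n) : array n n :=
  (\matrix_(i, j) if j == rev_ord i then P (ordS i) (ord_pred j) else P i j)%R.

Definition T_array (d : nat) : array (d * 2) (d * 2) :=
  block_array (fun a b : 'I_d => antidiag_array 2 (Posz (a * d + b))).

Definition T_family (d : nat) : d.-tuple (array (d * 2) (d * 2)) :=
  [tuple iter (2 * i) (@pi_AD1 (d * 2)) (T_array d) | i < d].

Definition base_array (g d : nat) : array (g %/ d ^ 2 * d) (g %/ d ^ 2 * d) :=
  block_array (fun a b : 'I_(g %/ d ^ 2) =>
    if a == b then diag_array d (Posz a) else all_star d d).

Definition Pstar_labelling (g d : nat) :=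
  labelling (g %/ d ^ 2 * d) (g %/ d ^ 2 * d).

(* The common row and column number of Pstar, equal to 2g when d ^ 2 %| g. *)
Definition Pstar_size (g d : nat) : nat := g %/ d ^ 2 * d * (d * 2).

Definition Pstar_admissible (g d : nat) (lab : Pstar_labelling g d) : Prop :=
  admissible (T_family d) (antidiag_array (d * 2) 0%R) (base_array g d) lab.

Definition Pstar_array (g d : nat) (lab : Pstar_labelling g d) :
    array (Pstar_size g d) (Pstar_size g d) :=
  lift (T_family d) (antidiag_array (d * 2) 0%R) (base_array g d) lab.

(* Main.v *)
Require Import Defs.
From mathcomp Require Import zify.

(* Write n = g/d. A row (or column) of Pstar is a block index A < n, a 2 x 2
   block index a < d and a bit x; replace a by its reversal when x = 1. In these
   coordinates Pstar has a star at (A, a, x), (B, b, y) exactly when x = y, or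
   A <> B and a <> b. A square array with stars on the diagonal, one star per
   column and each integer occurring twice is a labelling of the edges of the
   complete graph on the 2g indices. P_t is obtained from one such labelling by
   moving the edges between different bits: if the ends have equal A, both are
   shifted by t modulo n, and if they have equal a, both are shifted by t modulo
   d. Then equal integers of P_t and P_u, t <> u, come from ends that differ in
   both A and a. The same shift in the coordinate a describes T_{d^2}, so Pstar
   and the final array both follow from one statement on lifting regular PDAs. *)

Set Implicit Arguments.
Unset Strict Implicit.
Unset Printing Implicit Defensive.

(** * Counting occurrences and stars in block arrays *)

Lemma sum_mxtens m n (F : 'I_(m * n) -> nat) :
  \sum_k F k = \sum_(i < m) \sum_(j < n) F (mxtens_index (i, j)).
Proof.
rewrite pair_big; have tens_bij : bijective (@mxtens_index m n).
  by exists (@mxtens_unindex m n); [apply: mxtens_indexK | apply: mxtens_unindexK].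
rewrite (reindex _ (onW_bij _ tens_bij)).
by apply: eq_bigr => -[].
Qed.

Lemma block_arrayE m n p q (B : 'I_m -> 'I_n -> array p q) a b i j :
  block_array B (mxtens_index (a, i)) (mxtens_index (b, j)) = B a b i j.
Proof. by rewrite mxE !mxtens_indexK. Qed.

Lemma multE m n (P : array m n) s : mult P s = \sum_i \sum_j (P i j == Some s).
Proof.
rewrite /mult -sum1_card pair_big big_mkcond.
by apply: eq_bigr => c _; rewrite inE; case: eqP.
Qed.

Lemma occurs_mult m n (P : array m n) s : occurs P s = (0 < mult P s).
Proof.
apply/existsP/card_gt0P => [[i /existsP[j Pij]]|[[i j]]].
  by exists (i, j); rewrite inE.
by rewrite inE /= => Pij; exists i; apply/existsP; exists j.
Qed.

Definition nstar m n (P : array m n) j := #|[set i | P i j == None]|.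

Lemma nstarE m n (P : array m n) j : nstar P j = \sum_i (P i j == None).
Proof.
rewrite /nstar -sum1_card big_mkcond.
by apply: eq_bigr => c _; rewrite inE; case: eqP.
Qed.

Lemma mult_block_array m n p q (B : 'I_m -> 'I_n -> array p q) s :
  mult (block_array B) s = \sum_a \sum_b mult (B a b) s.
Proof.
rewrite multE sum_mxtens; apply: eq_bigr => a _.
rewrite (eq_bigr _ (fun i _ => sum_mxtens _)) exchange_big.
apply: eq_bigr => b _; rewrite multE.
by apply: eq_bigr => i _; apply: eq_bigr => j _; rewrite block_arrayE.
Qed.

Lemma nstar_block_array m n p q (B : 'I_m -> 'I_n -> array p q) b j :
  nstar (block_array B) (mxtens_index (b, j)) = \sum_a nstar (B a b) j.
Proof.
rewrite nstarE sum_mxtens; apply: eq_bigr => a _; rewrite nstarE.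
by apply: eq_bigr => i _; rewrite block_arrayE.
Qed.

Lemma nstar_relabel h m n (P : array m n) j : nstar (relabel h P) j = nstar P j.
Proof. by rewrite !nstarE; apply: eq_bigr => i _; rewrite mxE; case: (P i j). Qed.

(** * Lifting regular PDAs *)

Definition regular_pda (r Z : nat) (S : {fset int}) m n (P : array m n) : Prop :=
  is_pda n m Z S P /\ forall s, s \in S -> mult P s = r.

Lemma pda_memE K f Z S m n (P : array m n) s :
  is_pda K f Z S P -> (s \in S) = occurs P s.
Proof.
case=> _ inS _ occS _; apply/idP/idP; first exact: occS.
by case/existsP=> i /existsP[j /eqP/inS].
Qed.

Lemma occ_rank_lt m n (P : array m n) s i j :
  P i j = Some s -> occ_rank P i j < mult P s.
Proof.
move=> Pij; apply/proper_card/properP; split.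
  by apply/subsetP => c; rewrite !inE Pij => /andP[].
by exists (i, j); rewrite !inE /= ?Pij // ltnn andbF.
Qed.

(** Among cells of equal content the rank increases strictly with the row-major index. Hence
    different occurrences of one integer receive different members of the family in a lift. *)
Lemma occ_rank_inj m n (P : array m n) i j i' j' :
  P i j = P i' j' -> occ_rank P i j = occ_rank P i' j' -> (i, j) = (i', j').
Proof.
move=> eqP' eqr; apply: (can_inj (@mxtens_indexK m n)); apply: val_inj.
suff mono k l k' l' : P k l = P k' l' ->
    mxtens_index (k, l) < mxtens_index (k', l') ->
    occ_rank P k l < occ_rank P k' l'.
  case: (ltngtP (mxtens_index (i, j)) (mxtens_index (i', j'))) => // lt_ij.
    by have := mono _ _ _ _ eqP' lt_ij; rewrite eqr ltnn.
  by have := mono _ _ _ _ (esym eqP') lt_ij; rewrite eqr ltnn.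
move=> eqPk ltk; apply/proper_card/properP; split.
  apply/subsetP => c; rewrite !inE eqPk => /andP[-> ltc].
  exact: ltn_trans ltc ltk.
by exists (k, l); rewrite !inE /= ?ltnn ?andbF // eqPk eqxx.
Qed.

Section RegularLift.

Variables (r k m n p q Zb Zs Zf : nat) (Sb Ss Sf : {fset int}).
Variables (F : r.-tuple (array p q)) (Ps : array p q) (Pb : array m n).
Variable lab : labelling m n.
Hypothesis pdaB : regular_pda r Zb Sb Pb.
Hypothesis pdaS : regular_pda (r * k) Zs Ss Ps.
Hypothesis pdaF : forall t, regular_pda k Zf Sf (tnth F t).
Hypothesis compatF : blackburn_compat_family F Ps.
Hypothesis labP : admissible F Ps Pb lab.

(** The first component of the pairs passed to [lab]. Together with [blk] it lets star cells and
    integer cells of [Pb] be treated by one formula. *)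
Let tag a b : ('I_m * 'I_n) + int :=
  if Pb a b is Some s then inr s else inl (a, b).

Let blk a b : array p q :=
  if Pb a b is Some _ then nth (all_star p q) F (occ_rank Pb a b) else Ps.

Lemma lift_tagE :
  lift F Ps Pb lab =
  block_array (fun a b => relabel (fun x => lab (tag a b, x)) (blk a b)).
Proof.
apply/matrixP => i j; rewrite !mxE /tag /blk.
by case: (Pb _ _) => [s|]; rewrite mxE.
Qed.

Lemma rank_lt a b s : Pb a b = Some s -> occ_rank Pb a b < r.
Proof.
move=> Pab; have [[_ inS _ _ _] multB] := pdaB.
by rewrite -(multB _ (inS _ _ _ Pab)) occ_rank_lt.
Qed.

Lemma blkP a b s : Pb a b = Some s ->
  {t : 'I_r | blk a b = tnth F t & t = occ_rank Pb a b :> nat}.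
Proof.
move=> Pab; exists (Ordinal (rank_lt Pab)) => //.
by rewrite /blk Pab (tnth_nth (all_star p q)).
Qed.

Lemma used_blk a b i j x : blk a b i j = Some x -> used F Ps Pb (tag a b, x).
Proof.
rewrite /used /tag /=; case Pab: (Pb a b) => [s|] /= blkx.
  have [t blkE _] := blkP Pab; apply/andP; split.
    by apply/existsP; exists a; apply/existsP; exists b; rewrite Pab.
  apply/existsP; exists t; apply/existsP; exists i; apply/existsP; exists j.
  by rewrite -blkE blkx.
rewrite /= Pab /=; apply/existsP; exists i; apply/existsP; exists j.
by move: blkx; rewrite /blk Pab => ->.
Qed.

(** By admissibility an entry [lab (tag a b, x)] equals [lab u] only when the pair itself is [u]. *)
Lemma mult_blk a b u : u \in used F Ps Pb ->
  mult (relabel (fun x => lab (tag a b, x)) (blk a b)) (lab u) =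
  (tag a b == u.1) * mult (blk a b) u.2.
Proof.
move=> usu; rewrite !multE big_distrr; apply: eq_bigr => i _.
rewrite big_distrr; apply: eq_bigr => j _; rewrite mxE /= mulnb; congr nat_of_bool.
case blkx: (blk a b i j) => [x|] /=; last by rewrite andbF.
have inj_some (T : eqType) (y z : T) : (Some y == Some z) = (y == z) by [].
rewrite !inj_some; apply/eqP/andP => [|[/eqP tagE /eqP xE]].
  by move/(labP (used_blk blkx) usu) => <- /=.
by case: u tagE xE {usu} => ? ? /= -> ->.
Qed.

(** A finite enumeration of the pairs in [used] (for positive [r]), so that the integers of the lift
    can be counted. *)
Let keys : seq ((('I_m * 'I_n) + int) * int) :=
  [seq (inl c, x) | c <- enum [pred c : 'I_m * 'I_n | Pb c.1 c.2 == None], x <- Ss]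
  ++ [seq (inr s, x) | s <- Sb, x <- Sf].

Lemma mem_keys u : 0 < r -> (u \in keys) = (u \in used F Ps Pb).
Proof.
move=> r_gt0; rewrite mem_cat.
case: u => [[c|s] x]; rewrite -[in RHS]topredE /= /used /=.
  rewrite orbC; case: allpairsP => [[? [_ _ //]]|_ /=].
  apply/allpairsP/andP => [[[c' x'] /= []]|[Pc xS]].
    by rewrite mem_enum inE => Pc xS [-> ->]; rewrite -(pda_memE _ pdaS.1).
  by exists (c, x); rewrite mem_enum inE (pda_memE _ pdaS.1).
case: allpairsP => [[? [_ _ //]]|_ /=].
have memF t : (x \in Sf) = occurs (tnth F t) x by apply: pda_memE (pdaF t).1.
apply/allpairsP/andP => [[[s' x'] /= [sS xS [-> ->]]]|[sS /existsP[t xS]]].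
  rewrite -(pda_memE _ pdaB.1) sS; split=> //; apply/existsP.
  (* All members share the integer set [Sf], so the member of index 0 serves as a witness. *)
  exists (Ordinal r_gt0); rewrite -(pda_memE _ (pdaF _).1) //.
by exists (s, x); split=> //=; rewrite ?(pda_memE _ pdaB.1) // (memF t).
Qed.

Lemma size_keys : size keys = n * Zb * #|` Ss| + #|` Sb| * #|` Sf|.
Proof.
rewrite size_cat !size_allpairs -cardE; congr (_ * _ + _).
have [_ _ nB _ _] := pdaB.1.
rewrite -sum1_card big_mkcond -(pair_bigA _ (fun a b => if Pb a b == None then 1 else 0)).
rewrite exchange_big; transitivity (\sum_(b < n) Zb).
  apply: eq_bigr => b _ /=.
  by rewrite -(nB b) -sum1_card [RHS]big_mkcond; apply: eq_bigr => a _; rewrite inE.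
by rewrite sum_nat_const card_ord.
Qed.

Lemma uniq_keys : uniq keys.
Proof.
rewrite cat_uniq; apply/and3P; split.
- by apply: allpairs_uniq => //; [apply: enum_uniq | move=> [? ?] [? ?] _ _ [-> ->]].
- by apply/hasPn => u /allpairsP[[s x] [_ _ ->]]; apply/negP => /allpairsP[[? ?] []].
by apply: allpairs_uniq => // -[? ?] [? ?] _ _ [-> ->].
Qed.

(** Equal integers of the lift come from blocks with equal tags. Inside one block, (C3) of that
    block suffices. Two different base cells with the same integer have stars at the crossing base
    cells by (C3) of [Pb], so copies of [Ps] stand there and compatibility of the family gives the
    stars. *)
Lemma regular_lift : 0 < r -> exists2 S : {fset int},
  #|` S| = n * Zb * #|` Ss| + #|` Sb| * #|` Sf| &
  regular_pda (r * k) (Zb * Zs + (m - Zb) * Zf) S (lift F Ps Pb lab).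
Proof.
move=> r_gt0.
have usedE u : (u \in keys) = (u \in used F Ps Pb) by apply: mem_keys.
have lab_inj : {in keys &, injective lab}.
  by move=> u v; rewrite !usedE; apply: labP.
pose S := seq_fset tt (map lab keys).
have memS s : reflect (exists2 u, u \in used F Ps Pb & s = lab u) (s \in S).
  rewrite seq_fsetE; apply: (iffP mapP) => -[u ku ->]; exists u => //.
    by rewrite -usedE.
  by rewrite usedE.
have multS u : u \in used F Ps Pb -> mult (lift F Ps Pb lab) (lab u) = r * k.
  move=> usu; rewrite lift_tagE mult_block_array.
  under eq_bigr => a _ do under eq_bigr => b _ do rewrite (mult_blk _ _ usu).
  case: u usu => [[[a0 b0]|s] x] usu /=; move: usu; rewrite -topredE /= /used /=.
    case/andP=> /eqP Pab; rewrite -(pda_memE _ pdaS.1) => xS.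
    (* The tag of a star cell belongs to that cell alone, so a single copy of [Ps] contributes all
       [r * k] occurrences. *)
    rewrite (bigD1 a0) // (bigD1 b0) //= /tag /blk Pab eqxx mul1n pdaS.2 //.
    rewrite !big1 ?addn0 // => [a neqa|b neqb]; first rewrite big1 // => b _.
      by case: (Pb a b) => // ; rewrite (inj_eq inl_inj) xpair_eqE (negPf neqa).
    by case: (Pb a0 b) => // ; rewrite (inj_eq inl_inj) xpair_eqE (negPf neqb) andbF.
  case/andP; rewrite -(pda_memE _ pdaB.1) => sS /existsP[t0 xF].
  (* The integer [s] fills [r] base cells, and each member placed there contains [x] exactly [k]
     times. *)
  rewrite -(pdaB.2 _ sS) multE big_distrl; apply: eq_bigr => a _.
  rewrite big_distrl; apply: eq_bigr => b _.
  rewrite /tag; case Pab: (Pb a b) => [s'|] //=.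
  have -> : (inr s' == inr s :> ('I_m * 'I_n) + int) = (Some s' == Some s) by [].
  congr (_ * _); have [t -> _] := blkP Pab.
  by rewrite (pdaF t).2 // (pda_memE _ (pdaF t0).1).
have [[eqmn [m_gt0 n_gt0]] _ starB _ C3B] := pdaB.1.
have [[eqpq [p_gt0 q_gt0]] _ starS _ C3S] := pdaS.1.
exists S.
  by rewrite -size_keys size_seq_fset undup_id ?size_map // map_inj_in_uniq ?uniq_keys.
split; last by move=> s /memS[u usu ->]; apply: multS.
split.
- by rewrite !muln_gt0 m_gt0 n_gt0 p_gt0 q_gt0.
- move=> i j s; case: (mxtens_indexP i) => a i'; case: (mxtens_indexP j) => b j'.
  rewrite lift_tagE block_arrayE mxE; case blkx: (blk a b i' j') => [x|] //= [<-].
  by apply/memS; exists (tag a b, x) => //; apply: used_blk blkx.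
- move=> j; case: (mxtens_indexP j) => b j'; rewrite lift_tagE.
  rewrite -/(nstar _ _) nstar_block_array.
  have nstar_blk a : nstar (blk a b) j' = (Pb a b == None) * Zs + (Pb a b != None) * Zf.
    case Pab: (Pb a b) => [s|]; last by rewrite /blk Pab addn0 mul1n /nstar starS.
    have [t -> _] := blkP Pab; have [_ _ starF _ _] := (pdaF t).1.
    by rewrite mul1n /nstar starF.
  under eq_bigr do rewrite nstar_relabel nstar_blk.
  rewrite big_split -!big_distrl -nstarE [nstar _ _]starB; congr (_ + _ * _).
  suff eqm : nstar Pb b + \sum_a (Pb a b != None) = m.
    by rewrite -[m in RHS]eqm [nstar _ _]starB addKn.
  rewrite nstarE -big_split -[RHS]card_ord -sum1_card; apply: eq_bigr => a _ /=.
  by case: (_ == _).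
- move=> s /memS[u usu ->]; rewrite occurs_mult multS //.
  case: u usu => [[c|s'] x]; rewrite -topredE /= /used /= => /andP[_].
    by move=> xS; rewrite -(pdaS.2 x) -?occurs_mult ?(pda_memE _ pdaS.1).
  case/existsP=> t xF; rewrite muln_gt0 r_gt0 -((pdaF t).2 x) -?occurs_mult //.
  by rewrite (pda_memE _ (pdaF t).1).
move=> i1 j1 i2 j2 s; rewrite lift_tagE.
case: (mxtens_indexP i1) => a1 {}i1; case: (mxtens_indexP j1) => b1 {}j1.
case: (mxtens_indexP i2) => a2 {}i2; case: (mxtens_indexP j2) => b2 {}j2.
rewrite !block_arrayE !mxE => neq.
case blk1: (blk a1 b1 i1 j1) => [x1|] //= [<-].
case blk2: (blk a2 b2 i2 j2) => [x2|] //= [].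
move/(labP (used_blk blk2) (used_blk blk1)) => [eqtag eqx].
suff: blk a1 b2 i1 j2 = None /\ blk a2 b1 i2 j1 = None by case=> -> ->.
move: eqtag; rewrite /tag.
case Pab1: (Pb a1 b1) => [s1|]; case Pab2: (Pb a2 b2) => [s2|] // [].
  move=> eqs; have [t1 blkE1 rk1] := blkP Pab1; have [t2 blkE2 rk2] := blkP Pab2.
  rewrite blkE1 in blk1; rewrite blkE2 eqx in blk2.
  have [eqab|neqab] := eqVneq (a1, b1) (a2, b2).
    case: eqab => eqa eqb; subst a2 b2.
    have eqt : t2 = t1 by apply: val_inj; rewrite /= rk1 rk2.
    rewrite blkE1; rewrite eqt in blk2.
    have [_ _ _ _ C3F] := (pdaF t1).1.
    apply: C3F blk1 blk2; apply: contraNneq neq => -[-> ->] //.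
  have neqt : t1 != t2.
    apply: contraNneq neqab => eqt; apply/eqP; apply: (occ_rank_inj (P := Pb)).
      by rewrite Pab1 Pab2 eqs.
    by rewrite -rk1 -rk2 eqt.
  rewrite -eqs in Pab1; have [P12 P21] := C3B _ _ _ _ _ neqab Pab1 Pab2.
  by rewrite /blk P12 P21; apply: (compatF neqt) blk1 blk2.
move=> eqa eqb; subst a2 b2; move: blk1 blk2; rewrite /blk Pab1 eqx.
by apply: C3S; apply: contraNneq neq => -[-> ->].
Qed.

End RegularLift.

Lemma iter_ordS_val n t (i : 'I_n) : iter t (@ordS n) i = (i + t) %% n :> nat.
Proof.
elim: t => [|t IH] /=; first by rewrite addn0 modn_small.
by rewrite IH -[in LHS]addn1 modnDml addn1 addnS.
Qed.

Lemma iter_ordS_lt_inj n t u (i : 'I_n) : t < n -> u < n ->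
  iter t (@ordS n) i = iter u (@ordS n) i -> t = u.
Proof.
move=> ltt ltu /(congr1 val) /eqP /=; rewrite !iter_ordS_val eqn_modDl.
by rewrite !modn_small // => /eqP.
Qed.

Definition diag_shift n t (c : 'I_n * 'I_n) : 'I_n * 'I_n :=
  if c.1 == c.2 then (iter t (@ordS n) c.1, iter t (@ordS n) c.2) else c.

Lemma iter_ordS_inj n t : injective (iter t (@ordS n)).
Proof. by elim: t => [|t IH] i j //= /ordS_inj/IH. Qed.

Lemma diag_shift_diag n t (c : 'I_n * 'I_n) :
  ((diag_shift t c).1 == (diag_shift t c).2) = (c.1 == c.2).
Proof.
by rewrite /diag_shift; case: (boolP (c.1 == c.2)) => [/eqP->|/negPf] //=; rewrite eqxx.
Qed.

Lemma diag_shift_inj n t : injective (@diag_shift n t).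
Proof.
move=> [a b] [a' b'] eqc; have := diag_shift_diag t (a, b).
rewrite eqc diag_shift_diag; move: eqc; rewrite /diag_shift /=.
by case: eqP => [<-|_]; case: eqP => [<-|_] //; case=> /iter_ordS_inj->.
Qed.

Lemma diag_shift_swap n t (a b : 'I_n) :
  diag_shift t (b, a) = ((diag_shift t (a, b)).2, (diag_shift t (a, b)).1).
Proof. by rewrite /diag_shift /= eq_sym; case: eqP => [->|]. Qed.

(* On the diagonal the common value determines the shift, and off the diagonal
   nothing moves, so distinct shifts agree only at cells with no common
   coordinate. *)
Lemma diag_shift_neq n t u (a b a' b' : 'I_n) : t < n -> u < n -> t != u ->
  diag_shift t (a, b) = diag_shift u (a', b') -> a != b'.
Proof.
move=> ltt ltu neqtu eqc; apply/eqP => eqab; subst b'.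
have := diag_shift_diag t (a, b); rewrite eqc diag_shift_diag /=.
move: eqc; rewrite /diag_shift /=; case: eqP => [<-|_]; case: eqP => // => eqa'a [].
  by rewrite eqa'a => /(iter_ordS_lt_inj ltt ltu) eqtu; rewrite eqtu eqxx in neqtu.
by move=> eqa; case: eqa'a.
Qed.


(** * Edge labellings of complete graphs *)

Lemma set2_eq (T : finType) (a b a' b' : T) :
  [set a; b] = [set a'; b'] -> (a, b) = (a', b') \/ (a, b) = (b', a').
Proof.
move=> eqs; have [ha hb] : a \in [set a'; b'] /\ b \in [set a'; b'].
  by rewrite -eqs set21 set22.
have [ha' hb'] : a' \in [set a; b] /\ b' \in [set a; b].
  by rewrite eqs set21 set22.
case/set2P: ha => ea; case/set2P: hb => eb; subst a b; auto.
  by case/set2P: hb' => ->; left.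
by case/set2P: ha' => ->; right.
Qed.

Section EdgeArray.

Variables (N : nat) (W : finType) (w : 'I_N -> W) (phi : W * W -> W * W).

(** The unordered pair of ends is pickled, so both orientations of an edge get the same code. *)
Definition edge_code (c : W * W) : int := Posz (choice.pickle [set c.1; c.2]).

Definition edge_codes : {fset int} :=
  seq_fset tt [seq Posz (choice.pickle e) | e : {set W} <-
    enum [set e : {set W} | #|e| == 2]].

Definition edge_array : array N N :=
  (\matrix_(i, j) if i == j then None else Some (edge_code (phi (w i, w j))))%R.

Lemma edge_code_inj (c c' : W * W) :
  edge_code c = edge_code c' -> c = c' \/ c = (c'.2, c'.1).
Proof. by case: c c' => a b [a' b'] [] /(pcan_inj choice.pickleK) /set2_eq. Qed.

Lemma edge_code_swap u v : edge_code (v, u) = edge_code (u, v).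
Proof. by rewrite /edge_code /= setUC. Qed.

Lemma mem_edge_codes s :
  reflect (exists2 c, c.1 != c.2 & s = edge_code c) (s \in edge_codes).
Proof.
rewrite seq_fsetE; apply: (iffP mapP) => [[e]|[[u v] neq ->]].
  by rewrite mem_enum inE => /cards2P[u [v [neq eqe]]] ->; exists (u, v); rewrite // eqe.
by exists [set u; v] => //; rewrite mem_enum inE cards2 neq.
Qed.

Lemma card_edge_codes : #|` edge_codes| = 'C(#|W|, 2).
Proof.
rewrite size_seq_fset undup_id ?size_map -?cardE ?card_draws //.
rewrite map_inj_uniq ?enum_uniq // => e e' [].
exact: (pcan_inj choice.pickleK).
Qed.

Hypothesis w_bij : bijective w.
Hypothesis phi_inj : injective phi.
Hypothesis phi_swap : forall u v, phi (v, u) = ((phi (u, v)).2, (phi (u, v)).1).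

(** If the image has equal ends, [phi_swap] makes it the image of [(v, u)] too, and [phi] is
    injective. Off-diagonal cells therefore carry genuine edges. *)
Lemma phi_diag u v : (phi (u, v)).1 = (phi (u, v)).2 -> u = v.
Proof.
move=> eqphi; suff [] : (u, v) = (v, u) by [].
by apply: phi_inj; rewrite [RHS]phi_swap; case: (phi _) eqphi => ? ? /= ->.
Qed.

Lemma edge_array_sym i j : edge_array i j = edge_array j i.
Proof.
rewrite !mxE eq_sym; case: eqP => // _.
by rewrite [phi (w j, w i)]phi_swap edge_code_swap -surjective_pairing.
Qed.

Lemma edge_arrayP i j s : edge_array i j = Some s ->
  i != j /\ s = edge_code (phi (w i, w j)).
Proof. by rewrite mxE; case: eqP => // _ [<-]. Qed.

(** As [phi] is a permutation commuting with the swap of ends, each edge occurs at exactly one cell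
    and its transpose, and the crossing cells lie on the diagonal. *)
Lemma regular_edge_array : 0 < N -> regular_pda 2 1 edge_codes edge_array.
Proof.
move=> N_gt0; have [w' wK w'K] := w_bij; have [phi' phiK phi'K] := injF_bij phi_inj.
have multP s : s \in edge_codes -> mult edge_array s = 2.
  case/mem_edge_codes=> [[x y] neqxy ->].
  case: (phi' (x, y)) (phi'K (x, y)) => u v phiuv.
  (* A preimage with equal ends would be invariant under the swap, and so would its image [(x, y)],
     forcing [x = y]. *)
  have neqij : w' u != w' v.
    apply: contraNneq neqxy => equv /=.
    have {equv}equv : u = v by apply: (can_inj w'K).
    by have := phi_swap u u; rewrite -equv in phiuv; rewrite phiuv => -[->].
  transitivity #|[set (w' u, w' v); (w' v, w' u)]|; last first.
    by rewrite cards2 xpair_eqE negb_and neqij.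
  apply: eq_card => -[i j]; rewrite !inE /=; apply/eqP/idP.
    case/edge_arrayP => _; rewrite -phiuv => /esym/edge_code_inj[|].
      by move/phi_inj=> [<- <-]; rewrite !wK eqxx.
    by rewrite -phi_swap => /phi_inj[<- <-]; rewrite !wK eqxx orbT.
  case/orP=> /eqP[-> ->]; last rewrite edge_array_sym.
    by rewrite mxE (negPf neqij) !w'K phiuv.
  by rewrite mxE (negPf neqij) !w'K phiuv.
split=> //; split=> //.
- move=> i j s /edge_arrayP[neqij ->]; apply/mem_edge_codes; eexists; last by [].
  apply: contra neqij => /eqP/phi_diag eqw; apply/eqP; exact: (bij_inj w_bij).
- move=> j; transitivity #|[set j]|; last by rewrite cards1.
  by apply: eq_card => i; rewrite !inE mxE; case: (i == j).
- by move=> s /multP; rewrite occurs_mult => ->.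
move=> i1 j1 i2 j2 s neq /edge_arrayP[neq1 ->] /edge_arrayP[neq2].
case/edge_code_inj => [|]; last rewrite -phi_swap.
  by move/phi_inj=> [/(bij_inj w_bij) ei /(bij_inj w_bij) ej]; rewrite ei ej eqxx in neq.
by move/phi_inj=> [/(bij_inj w_bij) -> /(bij_inj w_bij) ->]; rewrite !mxE !eqxx.
Qed.

End EdgeArray.

(** * Arrays supported on the graph of a permutation: the diagonal and antidiagonal arrays *)

Definition graph_array n (f : 'I_n -> 'I_n) (t : int) : array n n :=
  (\matrix_(i, j) if j == f i then Some t else None)%R.

Section GraphArray.

Variables (n : nat) (f : 'I_n -> 'I_n) (t : int).
Hypothesis f_inj : injective f.

Lemma mult_graph_array s : mult (graph_array f t) s = (t == s) * n.
Proof.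
transitivity (\sum_(i < n) (t == s)); last by rewrite sum_nat_const card_ord mulnC.
rewrite multE; apply: eq_bigr => i _.
rewrite (bigD1 (f i)) //= mxE eqxx big1 ?addn0 // => j /negPf neqj.
by rewrite mxE neqj.
Qed.

Lemma nstar_graph_array j : nstar (graph_array f t) j = n.-1.
Proof.
have [g fK gK] := injF_bij f_inj.
rewrite -[RHS](congr1 predn (card_ord n)) -(cardC1 (g j)); apply: eq_card => i.
rewrite !inE mxE -(can_eq gK j) fK [i == _]eq_sym.
by case: (g j == i).
Qed.

Lemma regular_graph_array : 0 < n -> regular_pda n n.-1 [fset t]%fset (graph_array f t).
Proof.
move=> n_gt0; have multP s : s \in [fset t]%fset -> mult (graph_array f t) s = n.
  by rewrite inE => /eqP->; rewrite mult_graph_array eqxx mul1n.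
split=> //; split=> //.
- by move=> i j s; rewrite mxE inE; case: ifP => // _ [->].
- exact: nstar_graph_array.
- by move=> s /multP; rewrite occurs_mult => ->.
move=> i1 j1 i2 j2 s neq; rewrite !mxE.
case: eqP => // ej1 _; case: eqP => // ej2 _; subst j1 j2.
have {}neq : i1 != i2 by apply: contraNneq neq => ->.
by rewrite !(inj_eq f_inj) (negPf neq) eq_sym (negPf neq).
Qed.

End GraphArray.

Lemma regular_diag_array n t : 0 < n -> regular_pda n n.-1 [fset t]%fset (diag_array n t).
Proof. exact: (@regular_graph_array n id t (fun _ _ => id)). Qed.

Lemma mult_diag_array n t s : mult (diag_array n t) s = (t == s) * n.
Proof. exact: (@mult_graph_array n id). Qed.

Lemma regular_antidiag_array n t :
  0 < n -> regular_pda n n.-1 [fset t]%fset (antidiag_array n t).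
Proof. exact: (@regular_graph_array n (@rev_ord n) t rev_ord_inj). Qed.

Lemma mult_antidiag_array n t s : mult (antidiag_array n t) s = (t == s) * n.
Proof. exact: (@mult_graph_array n (@rev_ord n)). Qed.

Lemma nstar_antidiag_array n t j : nstar (antidiag_array n t) j = n.-1.
Proof. exact: (@nstar_graph_array n (@rev_ord n) t rev_ord_inj). Qed.

(** * The base array *)

Lemma mxtens_index_inj m n : injective (@mxtens_index m n).
Proof. exact: can_inj (@mxtens_indexK m n). Qed.

Definition Posz_below n : {fset int} := seq_fset tt [seq Posz i | i <- iota 0 n].

Lemma mem_Posz_below n s : reflect (exists i : 'I_n, s = Posz i) (s \in Posz_below n).
Proof.
rewrite seq_fsetE; apply: (iffP mapP) => [[i]|[i ->]].
  by rewrite mem_iota => /= lti ->; exists (Ordinal lti).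
by exists (val i); rewrite // mem_iota /=.
Qed.

Lemma card_Posz_below n : #|` Posz_below n| = n.
Proof.
by rewrite size_seq_fset undup_id ?size_map ?size_iota // map_inj_uniq ?iota_uniq // => ? ? [].
Qed.

(** The integer blocks are diagonal arrays and lie on the block diagonal, so only the main diagonal
    carries integers. *)
Lemma base_arrayE g d A B :
  base_array g d A B = if A == B then Some (Posz (mxtens_unindex A).1) else None.
Proof.
case: (mxtens_indexP A) => a t; case: (mxtens_indexP B) => b u.
rewrite block_arrayE (inj_eq (@mxtens_index_inj _ _)) xpair_eqE mxtens_indexK.
by case: (a =P b) => [_|_]; rewrite mxE // eq_sym.
Qed.

Lemma mult_base_array g d (a : 'I_(g %/ d ^ 2)) : mult (base_array g d) (Posz a) = d.
Proof.
have mult0 : mult (all_star d d) (Posz a) = 0.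
  by rewrite multE big1 // => i _; rewrite big1 // => j _; rewrite mxE.
rewrite mult_block_array (bigD1 a) //= (bigD1 a) //= eqxx mult_diag_array eqxx mul1n.
rewrite !big1 ?addn0 // => [b neqb|b neqb]; first rewrite big1 // => c _.
  by case: eqP => // _; rewrite mult_diag_array; rewrite eqz_nat val_eqE (negPf neqb).
by rewrite eq_sym (negPf neqb).
Qed.

Lemma regular_base_array g d : 0 < g %/ d ^ 2 -> 0 < d ->
  regular_pda d (g %/ d ^ 2 * d).-1 (Posz_below (g %/ d ^ 2)) (base_array g d).
Proof.
move=> m_gt0 d_gt0; split; last first.
  by move=> s /mem_Posz_below[a ->]; apply: mult_base_array.
split.
- by rewrite muln_gt0 m_gt0.
- move=> i j s; rewrite base_arrayE; case: eqP => // _ [<-].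
  by apply/mem_Posz_below; exists (mxtens_unindex i).1.
- move=> j; rewrite -[in RHS](card_ord (_ * d)) -(cardC1 j); apply: eq_card => i.
  by rewrite !inE base_arrayE; case: (i == j).
- by move=> s /mem_Posz_below[a ->]; rewrite occurs_mult mult_base_array.
move=> i1 j1 i2 j2 s; rewrite !base_arrayE.
case: (i1 =P j1) => // <- + _; case: (i2 =P j2) => // <- + _.
by rewrite xpair_eqE andbb => /negPf neq; rewrite neq [i2 == _]eq_sym neq.
Qed.

(** * The family obtained from [T_array] by antidiagonal shifts *)

Lemma rev_mxtens_index m n (a : 'I_m) (x : 'I_n) :
  rev_ord (mxtens_index (a, x)) = mxtens_index (rev_ord a, rev_ord x).
Proof.
apply: val_inj => /=; have := ltn_ord a; have := ltn_ord x.
case: m a => [[]//|m] a; case: n x => [[]//|n] x; nia.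
Qed.

(** Two unit steps amount to one step of the block index; this is why [pi_AD1] is iterated an even
    number of times. *)
Lemma ordS_mxtens_index d (a : 'I_d) (x : 'I_2) :
  ordS (ordS (mxtens_index (a, x))) = mxtens_index (ordS a, x).
Proof.
apply: val_inj; case: a x => a lta [x ltx] /=.
rewrite -addn1 modnDml addn1.
have [<-|neqa] := eqVneq a.+1 d.
  by rewrite modnn (_ : _.+2 = a.+1 * 2 + x) ?modnDl ?modn_small; lia.
by rewrite !modn_small; lia.
Qed.

Lemma ord_pred_rev n (i : 'I_n) : ord_pred (rev_ord i) = rev_ord (ordS i).
Proof.
apply: ordS_inj; rewrite ord_predK; apply: val_inj => /=.
have := ltn_ord i; rewrite leq_eqVlt => /orP[/eqP eqi|lti].
  by rewrite eqi modnn subn1 prednK ?modnn ?subnn //; lia.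
by rewrite !modn_small; lia.
Qed.

(** By [ord_pred_rev] the source of an antidiagonal cell is again antidiagonal, so the moves
    compose. *)
Lemma pi_AD1_twice n (P : array n n) i j :
  pi_AD1 (pi_AD1 P) i j =
  if j == rev_ord i then P (ordS (ordS i)) (rev_ord (ordS (ordS i))) else P i j.
Proof.
rewrite mxE; case: eqP => [->|/eqP/negPf neqj]; rewrite mxE ?neqj //.
by rewrite !ord_pred_rev eqxx.
Qed.

(** [diag_shift] conjugated by reversal of the second coordinate, so that it moves the antidiagonal.
    The value names the block of [T_array] whose integer ends up at block [c]. *)
Definition T_cell d t (c : 'I_d * 'I_d) : 'I_d * 'I_d :=
  ((diag_shift t (c.1, rev_ord c.2)).1, rev_ord (diag_shift t (c.1, rev_ord c.2)).2).

Lemma T_cell_inj d t : injective (@T_cell d t).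
Proof.
move=> [a b] [a' b'] /eqP; rewrite xpair_eqE (inj_eq rev_ord_inj) -xpair_eqE.
rewrite -!surjective_pairing (inj_eq (@diag_shift_inj _ t)) !xpair_eqE.
by rewrite (inj_eq rev_ord_inj) => /andP[/eqP /= -> /eqP /= ->].
Qed.

Lemma T_cell_antidiag d t (a : 'I_d) :
  T_cell t (a, rev_ord a) = (iter t (@ordS d) a, rev_ord (iter t (@ordS d) a)).
Proof. by rewrite /T_cell /diag_shift rev_ordK eqxx. Qed.

Lemma T_cell_off d t (a b : 'I_d) : b != rev_ord a -> T_cell t (a, b) = (a, b).
Proof.
rewrite -(inj_eq rev_ord_inj) rev_ordK eq_sym => /negPf neq.
by rewrite /T_cell /diag_shift neq rev_ordK.
Qed.

(** The integer cells of the antidiagonal blocks are exactly the antidiagonal cells of the whole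
    array, so the double shift carries each such block as a unit to its neighbour. *)
Lemma T_familyE d (t : 'I_d) : tnth (T_family d) t =
  block_array (fun a b => antidiag_array 2 (Posz (mxtens_index (T_cell t (a, b))))).
Proof.
rewrite tnth_mktuple; elim: (nat_of_ord t) => {t} [|t IH].
  apply/matrixP => i j; case: (mxtens_indexP i) => a x; case: (mxtens_indexP j) => b y.
  rewrite !block_arrayE !mxE; suff -> : T_cell 0 (a, b) = (a, b) by [].
  by rewrite /T_cell /diag_shift; case: (_ == _); rewrite /= rev_ordK.
rewrite (mulnS 2) iterD {}IH; apply/matrixP => i j.
case: (mxtens_indexP i) => a x; case: (mxtens_indexP j) => b y.
rewrite -[iter 2 _ _]/(pi_AD1 (pi_AD1 _)) pi_AD1_twice ordS_mxtens_index.
rewrite !rev_mxtens_index !block_arrayE.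
rewrite (inj_eq (@mxtens_index_inj _ _)) xpair_eqE !mxE.
have [->|neqb] := eqVneq b (rev_ord a); last by rewrite !(T_cell_off _ neqb).
rewrite !T_cell_antidiag !eqxx iterSr; by case: (y == _).
Qed.

Lemma Some_Posz_index_inj m n (c c' : 'I_m * 'I_n) :
  Some (Posz (mxtens_index c)) = Some (Posz (mxtens_index c')) -> c = c'.
Proof. by move=> eqc; apply: mxtens_index_inj; apply: val_inj; case: eqc. Qed.

(** Since [T_cell t] is a permutation, each integer fills the antidiagonal of a single 2 x 2 block,
    whose diagonal supplies the crossing stars. *)
Lemma regular_T d (t : 'I_d) :
  regular_pda 2 d (Posz_below (d * d)) (tnth (T_family d) t).
Proof.
have d_gt0 : 0 < d by case: d t => // -[].
have [cell' _ cellK] := injF_bij (@T_cell_inj d t).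
have multP s : s \in Posz_below (d * d) -> mult (tnth (T_family d) t) s = 2.
  case/mem_Posz_below=> k ->; rewrite T_familyE mult_block_array.
  case: (mxtens_indexP k) => a b; pose c := cell' (a, b).
  transitivity (\sum_c' (c' == c) * 2).
    rewrite pair_big; apply: eq_bigr => -[a' b'] _; rewrite mult_antidiag_array.
    rewrite eqz_nat val_eqE (inj_eq (@mxtens_index_inj _ _)) -(cellK (a, b)).
    by rewrite (inj_eq (@T_cell_inj _ _)).
  rewrite (bigD1 c) // eqxx big1 // => c' /negPf neqc; rewrite neqc //.
split=> //; split.
- by rewrite muln_gt0 d_gt0.
- move=> i j s; case: (mxtens_indexP i) => a x; case: (mxtens_indexP j) => b y.
  rewrite T_familyE block_arrayE mxE; case: eqP => // _ [<-].
  by apply/mem_Posz_below; exists (mxtens_index (T_cell t (a, b))).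
- move=> j; case: (mxtens_indexP j) => b y; rewrite -/(nstar _ _) T_familyE.
  rewrite nstar_block_array; under eq_bigr do rewrite nstar_antidiag_array.
  by rewrite sum_nat_const card_ord muln1.
- by move=> s /multP; rewrite occurs_mult => ->.
move=> i1 j1 i2 j2 s; rewrite T_familyE.
case: (mxtens_indexP i1) => a1 x1; case: (mxtens_indexP j1) => b1 y1.
case: (mxtens_indexP i2) => a2 x2; case: (mxtens_indexP j2) => b2 y2.
rewrite !block_arrayE !mxE => neq.
case: eqP => // ey1 <-; case: eqP => // ey2 /Some_Posz_index_inj/T_cell_inj[ea eb].
subst; have neqx : x1 != x2 by apply: contraNneq neq => ->.
by rewrite !(inj_eq rev_ord_inj) (negPf neqx) eq_sym (negPf neqx).
Qed.

(** After reversing the second block index, [diag_shift_neq] says that the crossing cells avoid the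
    antidiagonal blocks, hence the antidiagonal. *)
Lemma compat_T d : blackburn_compat_family (T_family d) (antidiag_array (d * 2) 0).
Proof.
move=> t u neqtu i1 j1 i2 j2 s; rewrite !T_familyE.
case: (mxtens_indexP i1) => a1 x1; case: (mxtens_indexP j1) => b1 y1.
case: (mxtens_indexP i2) => a2 x2; case: (mxtens_indexP j2) => b2 y2.
rewrite !block_arrayE !mxE.
case: eqP => // _ <-; case: eqP => // _ /Some_Posz_index_inj.
rewrite !rev_mxtens_index !(inj_eq (@mxtens_index_inj _ _)) !xpair_eqE.
move/(congr1 (fun c => (c.1, rev_ord c.2))); rewrite /= !rev_ordK -!surjective_pairing => eqc.
have := diag_shift_neq (ltn_ord u) (ltn_ord t) _ eqc; rewrite eq_sym => /(_ neqtu).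
have := diag_shift_neq (ltn_ord t) (ltn_ord u) neqtu (esym eqc).
rewrite -!(inj_eq rev_ord_inj a1) -!(inj_eq rev_ord_inj a2) !rev_ordK.
by rewrite ![rev_ord _ == _]eq_sym => /negPf-> /negPf->.
Qed.

(** * Coordinates on the indices of Pstar and the shift of edges *)

Definition flip d (x : 'I_2) (a : 'I_d) : 'I_d := if x == ord0 then a else rev_ord a.

Lemma flip_inj d x : injective (@flip d x).
Proof. by rewrite /flip; case: eqP => _ a b //; apply: rev_ord_inj. Qed.

Lemma ord2_neq (x y : 'I_2) : (y == rev_ord x) = (x != y).
Proof. by case: x y => -[|[|//]] ? [[|[|//]] ?]. Qed.

(** With different bits exactly one of the two block indices is reversed, which turns the
    antidiagonal condition into equality. *)
Lemma flip_neq d (x y : 'I_2) (a b : 'I_d) :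
  x != y -> (b == rev_ord a) = (flip x a == flip y b).
Proof.
case: x y => -[|[|//]] ? [[|[|//]] ?] // _; rewrite /flip -![_ == ord0]val_eqE /=.
by rewrite -(inj_eq rev_ord_inj) rev_ordK eq_sym.
Qed.

Definition coord n d (i : 'I_(n * (d * 2))) : 'I_n * 'I_d * 'I_2 :=
  let c := mxtens_unindex i in let p := mxtens_unindex c.2 in
  (c.1, flip p.2 p.1, p.2).

Lemma coordE n d (A : 'I_n) (a : 'I_d) (x : 'I_2) :
  coord (mxtens_index (A, mxtens_index (a, x))) = (A, flip x a, x).
Proof. by rewrite /coord !mxtens_indexK. Qed.

Lemma coord_bij n d : bijective (@coord n d).
Proof.
apply: inj_card_bij => [i j|]; last by rewrite !card_prod !card_ord mulnA.
case: (mxtens_indexP i) => A p; case: (mxtens_indexP p) => a x.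
case: (mxtens_indexP j) => B q; case: (mxtens_indexP q) => b y.
by rewrite !coordE => /eqP; rewrite !xpair_eqE => /andP[/andP[/eqP-> +] /eqP exy];
  rewrite exy (inj_eq (@flip_inj _ _)) => /eqP->.
Qed.

Definition pair_shift n d t (c : ('I_n * 'I_d * 'I_2) * ('I_n * 'I_d * 'I_2)) :=
  let: (u, v) := c in
  if u.2 == v.2 then (u, v) else
  let A := diag_shift t (u.1.1, v.1.1) in let b := diag_shift t (u.1.2, v.1.2) in
  ((A.1, b.1, u.2), (A.2, b.2, v.2)).

Lemma pair_shift_parity n d t (u v : 'I_n * 'I_d * 'I_2) :
  (pair_shift t (u, v)).1.2 = u.2 /\ (pair_shift t (u, v)).2.2 = v.2.
Proof. by rewrite /pair_shift; case: ifP. Qed.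

Lemma pair_shift_swap n d t (u v : 'I_n * 'I_d * 'I_2) :
  pair_shift t (v, u) = ((pair_shift t (u, v)).2, (pair_shift t (u, v)).1).
Proof.
rewrite /pair_shift eq_sym; case: ifP => // _.
by rewrite (diag_shift_swap t u.1.1) (diag_shift_swap t u.1.2).
Qed.

(** Bits are preserved, so both pairs fall into the shifting branch and can be compared coordinate
    by coordinate. *)
Lemma pair_shift_coords n d t u (c1 c2 c3 c4 : 'I_n * 'I_d * 'I_2) :
  c1.2 != c2.2 -> pair_shift t (c1, c2) = pair_shift u (c3, c4) ->
  [/\ diag_shift t (c1.1.1, c2.1.1) = diag_shift u (c3.1.1, c4.1.1),
      diag_shift t (c1.1.2, c2.1.2) = diag_shift u (c3.1.2, c4.1.2),
      c1.2 = c3.2 & c2.2 = c4.2].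
Proof.
move=> neq eqs; have [p1 p2] := pair_shift_parity t c1 c2.
have [p3 p4] := pair_shift_parity u c3 c4.
rewrite eqs p3 in p1; rewrite eqs p4 in p2.
move: eqs; rewrite /pair_shift p1 p2 (negPf neq).
case: (diag_shift t _) => ? ?; case: (diag_shift t _) => ? ?.
by case: (diag_shift u _) => ? ?; case: (diag_shift u _) => ? ? /= [-> -> -> ->].
Qed.

Lemma pair_shift_inj n d t : injective (@pair_shift n d t).
Proof.
move=> [u v] [u' v'] eqs; have [eq2|neq2] := eqVneq u.2 v.2.
  have [p1 p2] := pair_shift_parity t u v.
  have [p3 p4] := pair_shift_parity t u' v'.
  move: (eqs); rewrite /pair_shift -[u'.2]p3 -[v'.2]p4 -eqs p1 p2.
  by rewrite eq2 eqxx.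
have [] := pair_shift_coords neq2 eqs.
case: u v u' v' {eqs neq2} => [[? ?] ?] [[? ?] ?] [[? ?] ?] [[? ?] ?] /=.
by move=> /diag_shift_inj[-> ->] /diag_shift_inj[-> ->] -> ->.
Qed.

(** * Stars of Pstar, compatibility and the final counts *)

Section Star.

Variables (g d : nat) (lab : Pstar_labelling g d).

(** If [A = B] the block is a member of [T_family d], built from 2 x 2 antidiagonals, so only the
    bits matter. Otherwise it is a relabelled antidiagonal, whose integers sit where the bits differ
    and the flipped coordinates agree. *)
Lemma Pstar_starE i j : let u := coord i in let v := coord j in
  (Pstar_array lab i j == None) =
  (u.2 == v.2) || (u.1.1 != v.1.1) && (u.1.2 != v.1.2).
Proof.
case: (mxtens_indexP i) => A p; case: (mxtens_indexP p) => a x.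
case: (mxtens_indexP j) => B q; case: (mxtens_indexP q) => b y.
rewrite !coordE /= block_arrayE base_arrayE.
have [eqAB|neqAB] /= := eqVneq A B.
  (* The rank is below [d], so [nth] does not return its default. *)
  have rank_lt : occ_rank (base_array g d) A B < d.
    rewrite -[X in _ < X](mult_base_array (mxtens_unindex A).1).
    by apply: occ_rank_lt; rewrite base_arrayE eqAB eqxx.
  rewrite mxE (_ : nth _ _ _ = tnth (T_family d) (Ordinal rank_lt)); last first.
    by rewrite (tnth_nth (all_star _ _)).
  rewrite T_familyE block_arrayE mxE ord2_neq orbF.
  by case: (x == y).
rewrite !mxE rev_mxtens_index (inj_eq (@mxtens_index_inj _ _)) xpair_eqE ord2_neq.
have [_|neqxy] /= := eqVneq x y; first by rewrite andbF.
by rewrite andbT (flip_neq _ _ neqxy); case: (flip x a == flip y b).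
Qed.

End Star.

(** For equally oriented edges with different bits at the ends, [diag_shift_neq] separates the
    crossing pair in both coordinates. In the other cases the crossing pair has equal bits. Either
    way [Pstar_starE] gives a star. *)
Lemma compat_edge_family g d (lab : Pstar_labelling g d) (t u : 'I_d) :
  0 < g %/ d ^ 2 -> t != u ->
  blackburn_compat (edge_array (@coord (g %/ d ^ 2 * d) d) (pair_shift t))
    (edge_array (@coord (g %/ d ^ 2 * d) d) (pair_shift u)) (Pstar_array lab).
Proof.
set m := g %/ d ^ 2; move=> m_gt0 neqtu.
(* The first coordinate is shifted modulo [m * d], so the shift amounts must lie below that modulus
   too. *)
have lt_md (v : 'I_d) : v < m * d by apply: leq_trans (ltn_ord v) (leq_pmull _ _).
have star (c1 c2 c3 c4 : 'I_(m * d) * 'I_d * 'I_2) (v w : 'I_d) : v != w ->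
    pair_shift v (c1, c2) = pair_shift w (c3, c4) ->
    (c1.2 == c4.2) || (c1.1.1 != c4.1.1) && (c1.1.2 != c4.1.2) :> bool.
  move=> neqvw eqs; have [eq2|neq2] := eqVneq c1.2 c2.2.
    have [_ p2] := pair_shift_parity v c1 c2; have [_ p4] := pair_shift_parity w c3 c4.
    by rewrite eq2 -p2 eqs p4 eqxx.
  have [eqA eqb _ _] := pair_shift_coords neq2 eqs.
  rewrite (diag_shift_neq (lt_md _) (lt_md _) neqvw eqA).
  by rewrite (diag_shift_neq (ltn_ord _) (ltn_ord _) neqvw eqb) orbT.
move=> i1 j1 i2 j2 s /edge_arrayP[_ ->] /edge_arrayP[_ /edge_code_inj[|]] eqs.
  split; apply/eqP; rewrite Pstar_starE; first exact: star neqtu eqs.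
  by rewrite eq_sym in neqtu; apply: star neqtu (esym eqs).
have [p1 p2] := pair_shift_parity t (coord i1) (coord j1).
have [p3 p4] := pair_shift_parity u (coord i2) (coord j2).
rewrite eqs in p1 p2.
split; apply/eqP; rewrite Pstar_starE.
  by rewrite (etrans (esym p1) p4) eqxx.
by rewrite (etrans (esym p3) p2) eqxx.
Qed.

(** This is [regular_lift] with [r = d] and [k = 2]: the antidiagonal of length [d * 2] has the
    multiplicity [r * k] required of the star array. *)
Lemma regular_Pstar g d (lab : Pstar_labelling g d) :
  0 < g %/ d ^ 2 -> 0 < d -> Pstar_admissible lab ->
  let n := g %/ d ^ 2 * d in
  exists2 S : {fset int}, #|` S| = n * n.-1 + g %/ d ^ 2 * (d * d) &
  regular_pda (d * 2) (n.-1 * (d * 2).-1 + d) S (Pstar_array lab).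
Proof.
move=> m_gt0 d_gt0 labP n.
have n_gt0 : 0 < n by rewrite muln_gt0 m_gt0.
have d2_gt0 : 0 < d * 2 by rewrite muln_gt0 d_gt0.
have [S cardS regS] := regular_lift (regular_base_array m_gt0 d_gt0)
  (regular_antidiag_array 0 d2_gt0) (@regular_T d) (@compat_T d) labP d_gt0.
exists S; first by rewrite cardS cardfs1 muln1 !card_Posz_below.
(* Each column of the base array has one integer cell, which contributes the [d] stars of a member
   of [T_family d]. *)
by move: regS; rewrite (_ : n - n.-1 = 1) ?mul1n // subnE; lia.
Qed.

(** [regular_pda] uses the literal dimensions of the array; this passes to the intended parameters,
    equal to them only by arithmetic. *)
Lemma is_pda_resize K K' f f' Z Z' S m n (P : array m n) :
  is_pda K f Z S P -> K = K' -> f = f' -> Z = Z' -> is_pda K' f' Z' S P.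
Proof. by move=> pdaP <- <- <-. Qed.

(* The natural-number subtractions below never truncate: the star count is
   1 + (d - 1)(2g - g/d - d + 1), and 3g - g/d - 2d + d^2 is evaluated from left
   to right with g/d + 2d <= 3g. *)
Theorem lemma18 (g d : nat) (hg : 0 < g) (hd : 0 < d) (hdg : d ^ 2 %| g)
    (lab : Pstar_labelling g d) (hlab : Pstar_admissible lab) :
  exists P : d.-tuple (array (Pstar_size g d) (Pstar_size g d)),
    [/\ uniq P,
        forall t : 'I_d,
          is_pda_card (2 * g) (2 * g) 1 (g * (2 * g - 1)) (tnth P t),
        blackburn_compat_family P (Pstar_array lab)
      & forall lab' : labelling d d,
          admissible P (Pstar_array lab) (diag_array d 0%R) lab' ->
          is_regular_pda_card (2 * d) (2 * g * d) (2 * g * d)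
            (2 * g * d + g %/ d + 2 * d - (3 * g + d ^ 2))
            (g * (3 * g - g %/ d - 2 * d + d ^ 2))
            (lift P (Pstar_array lab) (diag_array d 0%R) lab')].
Proof.
have [m gE] : exists m, m = g %/ d ^ 2 by eexists.
have m_gt0 : 0 < m by rewrite gE divn_gt0 ?expn_gt0 ?hd // dvdn_leq.
have gmd : g = m * d * d by rewrite -mulnA mulnn gE divnK.
have gd : g %/ d = m * d by rewrite gmd mulnK.
have sizeE : Pstar_size g d = 2 * g by rewrite /Pstar_size -gE gmd; lia.
have n_gt0 : 0 < g %/ d ^ 2 * d by rewrite -gE muln_gt0 m_gt0.
have size_gt0 : 0 < Pstar_size g d by rewrite sizeE muln_gt0.
pose w := @coord (g %/ d ^ 2 * d) d.
have w_bij : bijective w := @coord_bij _ _.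
pose P := [tuple edge_array w (pair_shift t) | t < d].
pose SP := edge_codes ('I_(g %/ d ^ 2 * d) * 'I_d * 'I_2)%type.
have regP (t : 'I_d) : regular_pda 2 1 SP (tnth P t).
  rewrite tnth_mktuple.
  exact: (regular_edge_array w_bij (@pair_shift_inj _ _ t) (@pair_shift_swap _ _ t) size_gt0).
have compatP : blackburn_compat_family P (Pstar_array lab).
  by move=> t u neqtu; rewrite !tnth_mktuple; apply: compat_edge_family; rewrite -?gE.
(* The integers are the edges of the complete graph on [2 * g] vertices. *)
have cardP : #|` SP| = g * (2 * g - 1).
  rewrite card_edge_codes -(bij_eq_card w_bij) card_ord [X in 'C(X, 2)]sizeE.
  by rewrite bin2 -mulnA mul2n doubleK subn1.
exists P; split=> //.
(* Two equal members would make one array compatible with itself, so each of its integers would sit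
   at a star of Pstar. The cell [(i, j)] refutes this: it carries an integer, but its ends share [A]
   and have different bits. *)
- rewrite -[P in uniq P]map_tnth_enum map_inj_uniq ?enum_uniq // => t u eqtu.
  apply/eqP/negPn/negP => neqtu.
  pose A : 'I_(g %/ d ^ 2 * d) := Ordinal (n_gt0).
  pose a : 'I_d := Ordinal hd.
  pose i := mxtens_index (A, mxtens_index (a, ord0 : 'I_2)).
  pose j := mxtens_index (A, mxtens_index (a, ord_max : 'I_2)).
  have := compatP t u neqtu i j i j; rewrite -eqtu tnth_mktuple mxE.
  case: eqP => [eqij|_ /(_ _ erefl erefl)[]].
    by have := congr1 (@coord _ _) eqij; rewrite !coordE.
  by move/eqP; rewrite Pstar_starE !coordE.
- move=> t; exists SP; first exact: cardP.
  exact: (is_pda_resize (regP t).1 sizeE sizeE).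
move=> lab' lab'P.
have m_gt0' : 0 < g %/ d ^ 2 by rewrite -gE.
have [Ss cardSs regSs] := regular_Pstar m_gt0' hd hlab.
(* Again [r = d] and [k = 2]; each column meets [d - 1] copies of Pstar and one member of [P] with a
   single star. *)
have [S cardS regS] := regular_lift (regular_diag_array 0 hd) regSs regP compatP lab'P hd.
exists S.
  rewrite cardS cardfs1 cardP cardSs -gE gd gmd.
  (* Writing the positive [d] and [m] as successors lets the truncated subtractions be evaluated as
     polynomials. *)
  case: (d) hd => // e _; case: (m) m_gt0 => // k _.
  have -> : 3 * (k.+1 * e.+1 * e.+1) - k.+1 * e.+1 - 2 * e.+1 =
    3 * k * e * e + 5 * k * e + 2 * k + 3 * e * e + 3 * e by lia.
  by lia.
have sizeDE : d * Pstar_size g d = 2 * g * d by rewrite sizeE mulnC.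
split; last by move=> s sS; rewrite regS.2 // mulnC.
apply: (is_pda_resize regS.1 sizeDE sizeDE); rewrite -gE gd gmd.
case: (d) hd => // e _; case: (m) m_gt0 => // k _; lia.
Qed.
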